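(* Let $(K,d)$ be a compact metric space and let $\gamma=(\gamma_1,\dots,\gamma_N)$ be a system of proper contractions on $K$ satisfying the finite branch condition. Let $A=C(K)$ and let $X=X_\gamma$ be the associated right Hilbert $A$-module. Then the patched family $(\tilde u^{i,s}_k)_{(i,(s,k))\in\Lambda}$ (constructed in the context) is a basis for $X$.
   Context: **Contractions.** $N\ge2$. A map $\gamma_j:K\to K$ is a proper contraction if there are constants $0<c_1\le c_2<1$ with $c_1d(y,y')\le d(\gamma_j(y),\gamma_j(y'))\le c_2d(y,y')$ for all $y,y'$. Write $\gamma(y)=\{\gamma_1(y),\dots,\gamma_N(y)\}$ and $C(\gamma)=\{y\in K:\gamma_j(y)=\gamma_{j'}(y)\text{ for some }j\neq j'\}$. The finite branch condition says that $C(\gamma)$ is finite. **Module.** $\mathcal{C}=\bigcup_{j=1}^N\{(\gamma_j(y),y):y\in K\}$, $X_\gamma=C(\mathcal{C})$, with $(f\cdot b)(x,y)=f(x,y)b(y)$ and $(f|g)_A(y)=\sum_{j=1}^N\overline{f(\gamma_j(y),y)}g(\gamma_j(y),y)$. **Basis.** A countable family $(u_k)_{k\in\Lambda}$ in a right Hilbert $A$-module $X$ is a basis if for every $f\in X$ and $\varepsilon>0$ there is a finite $F_0\subset\Lambda$ such that $\|\sum_{k\in F}u_k(u_k|f)_A-f\|<\varepsilon$ for all finite $F$ with $F_0\subset F\subset\Lambda$. **Elementary families.** Let $K_1,K_2$ be compact metric spaces, and let $\sigma_1,\dots,\sigma_n:K_1\to K_2$ be proper contractions; if $n\ge2$ suppose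 there is $c\in K_1$ with $\sigma_1(c)=\dots=\sigma_n(c)$ and $\sigma_1(y),\dots,\sigma_n(y)$ pairwise different for every $y\neq c$. On the space of continuous functions on $\bigcup_j\{(\sigma_j(y),y):y\in K_1\}$ define: if $n=1$, the one-element family $u_1=1$. If $n\ge2$, fix $P>0$; for $i\ge1$ let $r_i:[0,\infty)\to[0,1]$ be $r_i(x)=1$ for $x\ge P/i$, $r_i(x)=\frac{2i}{P}x-1$ for $\frac{P}{2i}\le x\le\frac Pi$, $r_i(x)=0$ for $0\le x\le\frac P{2i}$, and $r_0=0$; put $v_i=(r_i-r_{i-1})^{1/2}$ and $\omega=e^{2\pi\sqrt{-1}/n}$; set $u_1=\frac1{\sqrt n}$ and $u_{1+(n-1)(i-1)+l}(\sigma_j(y),y)=\frac1{\sqrt n}\omega^{lj}v_i(d(y,c))$ for $i\ge1$, $1\le l\le n-1$, giving $(u_k)_{k\in\mathbb{N}}$. **Patching.** Let $C(\gamma)=\{c_1,\dots,c_m\}$ with distinct $c_i$. Take open neighborhoods $U_i$ of $c_i$ ($1\le i\le m$) with $C(\gamma)\cap\overline{U}_i=\{c_i\}$ and $\overline{U}_i\cap\overline{U}_{i'}=\emptyset$ for $i\ne i'$, open neighborhoods $V_i$ of $c_i$ with $\overline V_i\subset U_i$, and $U_{m+1}=K\setminus\bigcup_{i=1}^m\overline V_i$. Let $\{\psi_i\}_{i=1}^{m+1}$ be a continuous partition of unity with $\operatorname{supp}\psi_i\subset U_i$. For $1\le i\le m$ let $\gamma(c_i)=\{b^i_1,\dots,b^i_{r_i}\}$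 with distinct $b^i_s$, let $J_{i,s}=\{k:\gamma_k(c_i)=b^i_s\}$; for $i=m+1$ put $r_{m+1}=N$ and $J_{m+1,s}=\{s\}$. Let $\mathcal{C}_{i,s}=\{(\gamma_k(y),y):y\in\overline U_i,\ k\in J_{i,s}\}$; for fixed $i$ these sets are pairwise disjoint with union $\{(x,y)\in\mathcal C:y\in\overline U_i\}$. Let $(u^{i,s}_k)_{k\in\Lambda^{i,s}}$ be the elementary family on $\mathcal{C}_{i,s}$ for the maps $\gamma_k|_{\overline U_i}$, $k\in J_{i,s}$ (enumerated $1,\dots,n=\#J_{i,s}$, with $c=c_i$ if $n\ge2$), extended by $0$ to the other $\mathcal{C}_{i,s'}$. Let $\Lambda^i=\{(s,k):1\le s\le r_i,\ k\in\Lambda^{i,s}\}$ and $\Lambda=\bigcup_{i=1}^{m+1}\{(i,(s,k)):(s,k)\in\Lambda^i\}$. Define $\tilde u^{i,s}_k(\gamma_j(y),y)=u^{i,s}_k(\gamma_j(y),y)\psi_i(y)^{1/2}$ for $y\in\overline U_i$, extended by $0$ to $\mathcal{C}$. *)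

(* Defs.v *)
From HB Require Import structures.
From mathcomp Require Import all_boot all_order all_algebra finmap.
From mathcomp Require Import all_classical all_reals all_analysis.
From mathcomp Require Import complex.

Set Implicit Arguments.
Unset Strict Implicit.
Unset Printing Implicit Defensive.

Import Order.TTheory GRing.Theory Num.Theory.
Import numFieldNormedType.Exports.

Local Open Scope classical_set_scope.
Local Open Scope ring_scope.
Local Open Scope complex_scope.

(* Complex-valued functions take their values in R[i]^o, which is R[i] with   *)
(* the topology of the modulus; R[i] itself carries no topology.              *)

Section Contractions.
Context {R : realType}.

Definition proper_contraction {K1 K2 : metricType R} (g : K1 -> K2) : Prop :=
  exists c1 c2 : R, [/\ 0 < c1, c1 <= c2, c2 < 1 &
    forall y y' : K1,
      c1 * mdist y y' <= mdist (g y) (g y') <= c2 * mdist y y'].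

Context {K : metricType R} {N : nat}.
Implicit Type gamma : 'I_N -> K -> K.

Definition branch_set gamma : set K :=
  [set y | exists j j' : 'I_N, j != j' /\ gamma j y = gamma j' y].

Definition finite_branch_condition gamma : Prop := finite_set (branch_set gamma).

Definition cograph gamma : set (K * K) :=
  [set p | exists j : 'I_N, p = (gamma j p.2, p.2)].

Definition graph_pt gamma (j : 'I_N) (y : K) : set_type (cograph gamma) :=
  exist _ (gamma j y, y) (mem_set (ex_intro _ j erefl)).

End Contractions.

Section HilbertModule.
Context {R : realType} {K : metricType R} {N : nat} (gamma : 'I_N -> K -> K).

Definition C_K : set (K -> R[i]^o) := [set a | continuous a].

Definition X_gamma : set (set_type (cograph gamma) -> R[i]^o) :=
  [set f | continuous f].

Definition ract (f : set_type (cograph gamma) -> R[i]^o) (b : K -> R[i]^o) :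
    set_type (cograph gamma) -> R[i]^o :=
  fun p => f p * b (val p).2.

(* The sum is over the indices j, so a point of the cograph lying on several  *)
(* branches is counted with multiplicity.                                     *)
Definition inner (f g : set_type (cograph gamma) -> R[i]^o) : K -> R[i]^o :=
  fun y => \sum_(j < N) conjc (f (graph_pt gamma j y)) * g (graph_pt gamma j y).

Definition sup_norm (a : K -> R[i]^o) : R :=
  sup (range (fun y => Normc.normc (a y))).

Definition module_norm (f : set_type (cograph gamma) -> R[i]^o) : R :=
  Num.sqrt (sup_norm (inner f f)).

Definition is_basis (I : choiceType) (Lambda : set I)
    (u : I -> set_type (cograph gamma) -> R[i]^o) : Prop :=
  [/\ countable Lambda,
      forall k, Lambda k -> X_gamma (u k) &
      forall (f : set_type (cograph gamma) -> R[i]^o) (e : R),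
        X_gamma f -> 0 < e ->
        exists2 F0 : {fset I}, [set` F0] `<=` Lambda &
          forall F : {fset I}, (F0 `<=` F)%fset -> [set` F] `<=` Lambda ->
            module_norm (\sum_(k <- F) ract (u k) (inner (u k) f) - f) < e].

(* A = C(K) acts on X, and the inner product of X is A-valued. *)

Lemma proper_contraction_continuous {K1 K2 : metricType R} (g : K1 -> K2) :
  proper_contraction g -> continuous g.
Proof.
move=> [c1 [c2 [c10 c12 c21 gc]]] x; apply/cvg_ballP => e e0.
near=> y; rewrite ballEmdist /=; have /andP[_ le2] := gc x y.
apply: (le_lt_trans le2); apply: (@le_lt_trans _ _ (1 * mdist x y)).
  by rewrite ler_wpM2r ?mdist_ge0// ltW.
rewrite mul1r; have : ball x e y by near: y; exact: nbhsx_ballx.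
by rewrite ballEmdist.
Unshelve. all: by end_near. Qed.

Lemma graph_pt_continuous (j : 'I_N) :
  proper_contraction (gamma j) -> continuous (graph_pt gamma j).
Proof.
move=> /proper_contraction_continuous gc.
apply: continuous_comp_initial => y.
by apply: cvg_pair => /=; [exact: gc|exact: cvg_id].
Qed.

Lemma conjc_continuous : continuous (fun z : R[i]^o => z^* : R[i]^o).
Proof.
move=> x A [e e0 eA]; exists e => //= y xy; apply: eA => /=.
by rewrite -(rmorphB (@conjc R)) /= normcJ.
Qed.

Lemma ract_X_gamma f b : X_gamma f -> C_K b -> X_gamma (ract f b).
Proof.
rewrite /X_gamma /C_K /= => fc bc p.
apply: (@cvgM R[i] _ (nbhs p) _ f (fun p => b (val p).2)); first exact: fc.
have snd_val : {for p, continuous (snd \o (val : set_type (cograph gamma) -> K * K))}.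
  by apply: continuous_comp; [exact: initial_continuous|exact: cvg_snd].
exact: (continuous_comp snd_val (bc _)).
Qed.

Lemma inner_C_K f g : (forall j, proper_contraction (gamma j)) ->
  X_gamma f -> X_gamma g -> C_K (inner f g).
Proof.
rewrite /X_gamma /C_K /= => gc fc hc y.
have gpt j : {for y, continuous (graph_pt gamma j)} by exact: graph_pt_continuous.
apply: (@cvg_big R[i]^o) => [|j _];
  first by move=> x; exact: (@cvgD R[i] R[i]^o _ (nbhs x) _ fst snd _ _ cvg_fst cvg_snd).
apply: (@cvgM R[i] _ (nbhs y) _ (fun y => conjc (f (graph_pt gamma j y)))
  (fun y => g (graph_pt gamma j y))); last exact: (continuous_comp (gpt j) (hc _)).
have fgpt := continuous_comp (gpt j) (fc _).
exact: (continuous_comp fgpt (@conjc_continuous _)).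
Qed.

End HilbertModule.

Section ElementaryFamily.
Context {R : realType}.

Definition ramp (P : R) (i : nat) (x : R) : R :=
  if i == 0%N then 0
  else if P / i%:R <= x then 1
  else if P / (2 * i%:R) <= x then 2 * i%:R / P * x - 1
  else 0.

Definition bump_fun (P : R) (i : nat) (x : R) : R :=
  Num.sqrt (ramp P i x - ramp P i.-1 x).

Definition omega (n : nat) : R[i] :=
  cos (2 * pi / n%:R) +i* sin (2 * pi / n%:R).

Definition elementary_index (n : nat) : set nat :=
  if n == 1%N then [set 1%N] else [set k | (0 < k)%N].

(* Value at (sigma_j y, y) of the k-th function (k >= 1), where t = d(y, c)   *)
(* and j = 1, ..., n.  For n, k >= 2 the pair (i, l) is the one with          *)
(* i >= 1, 1 <= l <= n - 1 and k = 1 + (n - 1)(i - 1) + l.                    *)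
Definition elementary_value (n : nat) (P : R) (k j : nat) (t : R) : R[i] :=
  if n == 1%N then 1
  else if k == 1%N then (Num.sqrt n%:R)^-1%:C
  else let i := ((k - 2) %/ n.-1).+1 in
       let l := ((k - 2) %% n.-1).+1 in
       (Num.sqrt n%:R)^-1%:C * omega n ^+ (l * j) * (bump_fun P i t)%:C.

Context {K1 K2 : metricType R}.

(* Elementary family of the maps sigma_1, ..., sigma_n (sigma_(j+1) is        *)
(* [sigma j]) restricted to D, with common branch point [c] (unused, hence    *)
(* possibly None, when n = 1), extended by 0 off the cograph of the           *)
(* restrictions.  The choice of j made by [pick] is irrelevant, see           *)
(* elementaryE below.                                                         *)
Definition elementary (n : nat) (sigma : 'I_n -> K1 -> K2) (D : set K1)
    (c : option K1) (P : R) (k : nat) (p : K2 * K1) : R[i] :=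
  if [pick j | (p.2 \in D) && (p.1 == sigma j p.2)] is Some j
  then elementary_value n P k j.+1 (if c is Some c0 then mdist p.2 c0 else 0)
  else 0.

Lemma ramp0 (P : R) (i : nat) : 0 < P -> ramp P i 0 = 0.
Proof.
move=> P0; rewrite /ramp; case: i => [|i] //=.
have i0 : 0 < i.+1%:R :> R by rewrite ltr0n.
by rewrite !leNgt !divr_gt0 ?mulr_gt0.
Qed.

Lemma elementaryE (n : nat) (sigma : 'I_n -> K1 -> K2) (D : set K1)
    (c : K1) (P : R) (k : nat) (j : 'I_n) (y : K1) :
  0 < P ->
  (forall y j j', D y -> sigma j y = sigma j' y -> j != j' -> y = c) ->
  D y ->
  elementary sigma D (Some c) P k (sigma j y, y) =
  elementary_value n P k j.+1 (mdist y c).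
Proof.
move=> P0 sc Dy; rewrite /elementary; case: pickP => [j' /=|/(_ j)]; last first.
  by rewrite /= mem_set// eqxx.
move=> /andP[_ /eqP sjj']; have [->//|jj'] := eqVneq j' j.
have yc : y = c by apply: (sc y j' j).
subst y; rewrite /elementary_value mdistxx /bump_fun !ramp0// subrr sqrtr0.
by case: ifP => // _; case: ifP => // _; rewrite !mulr0.
Qed.

Lemma elementary_valueE (n : nat) (P : R) (i l j : nat) (t : R) :
  (1 < n)%N -> (0 < i)%N -> (0 < l < n)%N ->
  elementary_value n P (1 + (n - 1) * (i - 1) + l) j t =
  (Num.sqrt n%:R)^-1%:C * omega n ^+ (l * j) * (bump_fun P i t)%:C.
Proof.
case: n => [|[|n]]// _; case: i => // i _; case: l => // l /andP[_ ln].
have -> : (1 + (n.+2 - 1) * (i.+1 - 1) + l.+1 = (i * n.+1 + l).+2)%N.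
  by rewrite !subn1 /= mulnC addnS -addnA.
rewrite /elementary_value /= !subSS subn0.
by rewrite divnMDl// modnMDl modn_small// divn_small// addn0.
Qed.

End ElementaryFamily.

Section Patching.
Context {R : realType} {K : metricType R} {N : nat} (gamma : 'I_N -> K -> K).

(* The indices 1, ..., m, m + 1 of the pieces are encoded by option 'I_m,     *)
(* None standing for m + 1.                                                   *)

Definition patch_nbhd (m : nat) (U V : 'I_m -> set K) (i : option 'I_m) : set K :=
  if i is Some i0 then U i0 else ~` \bigcup_i0 closure (V i0).

Definition nb_values (m : nat) (r : 'I_m -> nat) (i : option 'I_m) : nat :=
  if i is Some i0 then r i0 else N.

Definition branches (m : nat) (c : 'I_m -> K) (r : 'I_m -> nat)
    (b : forall i, 'I_(r i) -> K) (i : option 'I_m) :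
    'I_(nb_values r i) -> {set 'I_N} :=
  match i with
  | Some i0 => fun s => [set k | gamma k (c i0) == b i0 s]%SET
  | None => fun s => [set s]%SET
  end.

Record patching := Patching {
  pt_m : nat ;
  pt_c : 'I_pt_m -> K ;
  pt_c_inj : injective pt_c ;
  pt_c_range : range pt_c = branch_set gamma ;
  pt_U : 'I_pt_m -> set K ;
  pt_U_open : forall i, open (pt_U i) ;
  pt_U_c : forall i, pt_U i (pt_c i) ;
  pt_U_branch : forall i, branch_set gamma `&` closure (pt_U i) = [set pt_c i] ;
  pt_U_disjoint : forall i i', i != i' -> closure (pt_U i) `&` closure (pt_U i') = set0 ;
  pt_V : 'I_pt_m -> set K ;
  pt_V_open : forall i, open (pt_V i) ;
  pt_V_c : forall i, pt_V i (pt_c i) ;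
  pt_V_U : forall i, closure (pt_V i) `<=` pt_U i ;
  pt_psi : option 'I_pt_m -> K -> R ;
  pt_psi_continuous : forall i, continuous (pt_psi i) ;
  pt_psi_ge0 : forall i y, 0 <= pt_psi i y ;
  pt_psi_sum : forall y, \sum_i pt_psi i y = 1 ;
  pt_psi_supp : forall i, closure [set y | pt_psi i y != 0] `<=` patch_nbhd pt_U pt_V i ;
  pt_r : 'I_pt_m -> nat ;
  pt_b : forall i, 'I_(pt_r i) -> K ;
  pt_b_inj : forall i, injective (pt_b (i := i)) ;
  pt_b_range : forall i, range (pt_b (i := i)) = range (fun j => gamma j (pt_c i)) ;
  (* enumeration of each J_(i,s), used to number the maps of its family *)
  pt_enumJ : forall i (s : 'I_(nb_values pt_r i)), 'I_#|branches pt_c pt_b s| -> 'I_N ;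
  pt_enumJ_inj : forall i s, injective (@pt_enumJ i s) ;
  pt_enumJ_in : forall i s a, @pt_enumJ i s a \in branches pt_c pt_b s ;
  (* the constant P of each elementary family; irrelevant when #J_(i,s) = 1 *)
  pt_P : forall i : option 'I_pt_m, 'I_(nb_values pt_r i) -> R ;
  pt_P_gt0 : forall i s, 0 < @pt_P i s
}.

Variable D : patching.

Definition patch_index_type : choiceType :=
  {i : option 'I_(pt_m D) & ('I_(nb_values (@pt_r D) i) * nat)%type}.

Definition patch_index : set patch_index_type :=
  [set x | elementary_index #|branches (@pt_c D) (@pt_b D) (tagged x).1| (tagged x).2].

Definition local_family (i : option 'I_(pt_m D)) (s : 'I_(nb_values (@pt_r D) i))
    (k : nat) (p : K * K) : R[i] :=
  elementary (fun a => gamma (pt_enumJ (s := s) a)) (closure (patch_nbhd (@pt_U D) (@pt_V D) i))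
    (omap (@pt_c D) i) (pt_P s) k p.

Definition patched_family (x : patch_index_type) :
    set_type (cograph gamma) -> R[i]^o :=
  fun p => local_family (tagged x).1 (tagged x).2 (val p) *
           (Num.sqrt (pt_psi (tag x) (val p).2))%:C.

End Patching.

(* Main.v *)
Require Import Defs.
From mathcomp Require Import all_boot all_order all_algebra finmap.
From mathcomp Require Import all_classical all_reals all_analysis.
From mathcomp Require Import complex.
From mathcomp Require Import ring lra.

(* At a point y of K an element of X_gamma is a vector of C^N.  On a piece    *)
(* (i, s) with n = #J_(i,s), Parseval's identity for the discrete Fourier     *)
(* transform shows that the functions with ramp index at most M satisfy       *)
(*   |h|^2 - sum_k |(u_k|h)|^2 = (1 - r_M) (|h|^2 - |sum_j h_j|^2 / n).       *)
(* Weighting by the partition of unity gives Bessel's inequality for finite   *)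
(* subfamilies of the patched family, and Bessel's inequality alone implies   *)
(*   |f - sum_F u_k (u_k|f)|^2 <= |f|^2 - sum_F |(u_k|f)|^2,                  *)
(* whose right-hand side decreases in F.  For F = F0, the functions with ramp *)
(* index at most M, it is the weighted sum of the defects above: 1 - r_M      *)
(* vanishes away from c_i, and near c_i the values of f on the branches in    *)
(* J_(i,s) nearly agree, so that their distance to the constants is small.    *)

Set Implicit Arguments.
Unset Strict Implicit.
Unset Printing Implicit Defensive.

Import Order.TTheory GRing.Theory Num.Theory.
Import numFieldNormedType.Exports.

Local Open Scope classical_set_scope.
Local Open Scope complex_scope.
Local Open Scope ring_scope.

(** * Finite Hermitian sums *)

(** Fix [y], and for a finite [F] let T be the sum over [F] of the rank-one operators h -> u_k
    (u_k|h) on C^N. [patched_bessel] says T <= 1, and T >= 0 is clear, so T^2 <= T and (1 - T)^2 <=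
    1 - T. This is [residual_le_of_bessel]: the squared error is at most the quadratic form of 1 -
    T, which can only decrease as [F] grows. For [index_upto D M] that form is computed exactly by
    [patched_inner_sum], through [parseval_prim_root] and the telescoping of v_i^2 = r_i - r_(i-1)
    in [elementary_sum]. [near_dispersion] makes it small uniformly in [y], and one [M] serves the
    finitely many pieces. *)

Lemma ler_sum_subseq_mem (F : numDomainType) (I : eqType) (f : I -> F)
    (s1 s2 : seq I) :
  uniq s1 -> {subset s1 <= s2} -> (forall i, 0 <= f i) ->
  \sum_(i <- s1) f i <= \sum_(i <- s2) f i.
Proof.
move=> us1 s12 f0; elim: s1 us1 s2 s12 => [|i s1 IH] /= us1 s2 s12.
  by rewrite big_nil sumr_ge0.
move: us1 => /andP[is1 us1].
rewrite big_cons (perm_big _ (perm_to_rem (s12 i (mem_head _ _)))) big_cons.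
rewrite lerD2l; apply: IH => // j js1.
have := s12 j; rewrite in_cons js1 orbT => /(_ isT).
rewrite (perm_mem (perm_to_rem (s12 i (mem_head _ _)))) in_cons.
by case/orP => [/eqP ji|//]; rewrite -ji js1 in is1.
Qed.

Lemma sum_nat_mul (V : nmodType) (q m : nat) (f : nat -> V) :
  \sum_(0 <= k < q * m) f k =
  \sum_(0 <= i < m) \sum_(0 <= l < q) f (q * i + l)%N.
Proof.
elim: m => [|m IH]; first by rewrite muln0 !big_geq.
rewrite big_nat_recr//= -IH mulnSr (@big_cat_nat _ _ _ (q * m))//= ?leq_addr//.
congr (_ + _); rewrite -[X in \sum_(X <= _ < _) _](add0n (q * m)%N) big_addn addKn.
by apply: eq_bigr => i _; rewrite addnC.
Qed.

Section HermitianSums.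
Variable C : numClosedFieldType.

Lemma residual_le_of_bessel (I : Type) (N : nat) (s : seq I)
    (u : I -> 'I_N -> C) (g : 'I_N -> C) :
  (forall h : 'I_N -> C,
    \sum_(k <- s) `|\sum_j (u k j)^* * h j| ^+ 2 <= \sum_j `|h j| ^+ 2) ->
  \sum_j `|\sum_(k <- s) u k j * (\sum_j' (u k j')^* * g j') - g j| ^+ 2 <=
  \sum_j `|g j| ^+ 2 - \sum_(k <- s) `|\sum_j (u k j)^* * g j| ^+ 2.
Proof.
move=> bessel.
pose a k := \sum_j (u k j)^* * g j.
pose h j := \sum_(k <- s) u k j * a k.
pose b k := \sum_j (u k j)^* * h j.
have hg : \sum_j h j * (g j)^* = \sum_(k <- s) `|a k| ^+ 2.
  under eq_bigr do rewrite /h big_distrl/=.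
  rewrite exchange_big/=; apply: eq_bigr => k _.
  rewrite normCK {3}/a rmorph_sum/= big_distrr/=; apply: eq_bigr => j _.
  by rewrite rmorphM/= conjCK; ring.
have hh : \sum_j `|h j| ^+ 2 = \sum_(k <- s) (b k)^* * a k.
  under eq_bigr do rewrite normCK {1}/h big_distrl/=.
  rewrite exchange_big/=; apply: eq_bigr => k _.
  rewrite /b rmorph_sum/= big_distrl/=; apply: eq_bigr => j _.
  by rewrite rmorphM/= conjCK; ring.
have h2 : \sum_j `|h j| ^+ 2 <= \sum_(k <- s) `|a k| ^+ 2.
  (* 2 |h|^2 = 2 Re sum_k (b_k)^* a_k <= sum_k |b_k|^2 + sum_k |a_k|^2, and  *)
  (* sum_k |b_k|^2 <= |h|^2 by Bessel's inequality for h.                     *)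
  have : \sum_j `|h j| ^+ 2 *+ 2 <=
         \sum_(k <- s) `|b k| ^+ 2 + \sum_(k <- s) `|a k| ^+ 2.
    have hh' : \sum_j `|h j| ^+ 2 = \sum_(k <- s) (a k)^* * b k.
      have /CrealP <- : \sum_j `|h j| ^+ 2 \is Num.real.
        by apply/ger0_real/sumr_ge0 => j _; rewrite exprn_ge0.
      rewrite hh rmorph_sum/=; apply: eq_bigr => k _.
      by rewrite rmorphM/= conjCK mulrC.
    rewrite sumrMnl mulr2n {1}hh hh' -!big_split/=; apply: ler_sum => k _.
    rewrite -subr_ge0; have := exprn_ge0 2 (normr_ge0 (a k - b k)).
    congr (0 <= _); rewrite !normCK rmorphB/=; ring.
  rewrite sumrMnl mulr2n => /le_trans/(_ (lerD (bessel h) (lexx _))).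
  by rewrite lerD2l.
(* By [hg] the cross term is real, so |h - g|^2 = |h|^2 - 2 sum |a_k|^2 + |g|^2; [h2] then absorbs
   one of the two sums. *)
rewrite (_ : \sum_j _ = \sum_j `|h j| ^+ 2 - \sum_j h j * (g j)^*
    - (\sum_j h j * (g j)^*)^* + \sum_j `|g j| ^+ 2).
  have /CrealP -> : \sum_j h j * (g j)^* \is Num.real.
    by rewrite hg; apply/ger0_real/sumr_ge0 => k _; rewrite exprn_ge0.
  by rewrite hg addrC lerD2l gerDr subr_le0.
rewrite rmorph_sum/= -!sumrB -big_split/=; apply: eq_bigr => j _.
by rewrite -/(h j) !normCK rmorphB rmorphM/= conjCK; ring.
Qed.

(* The squared distance of [h] to the constant vectors. *)
Definition dispersion (n : nat) (h : 'I_n -> C) : C :=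
  \sum_j `|h j| ^+ 2 - n%:R^-1 * `|\sum_j h j| ^+ 2.

(** Pythagoras: h - z is its component orthogonal to the constants plus the constant mean(h) - z,
    whose squared norm is the last term. *)
Lemma sum_normB_dispersion (n : nat) (h : 'I_n -> C) (z : C) : (0 < n)%N ->
  \sum_j `|h j - z| ^+ 2 =
  dispersion h + n%:R^-1 * `|\sum_j h j - n%:R * z| ^+ 2.
Proof.
move=> n0; have nE : n%:R != 0 :> C by rewrite pnatr_eq0 -lt0n.
rewrite /dispersion.
rewrite (_ : \sum_j `|h j - z| ^+ 2 = \sum_j `|h j| ^+ 2
    - (\sum_j h j) * z^* - (\sum_j h j)^* * z + n%:R * (z * z^*)).
  rewrite !normCK rmorphB rmorphM/= conjC_nat; set S := \sum_j h j.
  by field.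
rewrite rmorph_sum/= !big_distrl/= -!sumrB mulr_natl -[n in _ *+ n]card_ord.
rewrite -sumr_const -big_split/=; apply: eq_bigr => j _.
by rewrite !normCK rmorphB/=; ring.
Qed.

Lemma dispersion_ge0 (n : nat) (h : 'I_n -> C) : (0 < n)%N -> 0 <= dispersion h.
Proof.
move=> n0; have nE : n%:R != 0 :> C by rewrite pnatr_eq0 -lt0n.
have := sum_normB_dispersion h (n%:R^-1 * \sum_j h j) n0.
rewrite mulVKf// subrr normr0 expr0n mulr0 addr0 => <-.
by apply: sumr_ge0 => j _; rewrite exprn_ge0.
Qed.

Lemma dispersion_le (n : nat) (h : 'I_n -> C) (z : C) : (0 < n)%N ->
  dispersion h <= \sum_j `|h j - z| ^+ 2.
Proof.
move=> n0; rewrite (sum_normB_dispersion _ _ n0) lerDl.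
by rewrite mulr_ge0 ?exprn_ge0// invr_ge0.
Qed.

Lemma sum_prim_root (n d : nat) (w : C) : n.-primitive_root w ->
  ~~ (n %| d)%N -> \sum_(l < n) w ^+ (l * d) = 0.
Proof.
move=> wn nd; have wd : w ^+ d - 1 != 0.
  by rewrite subr_eq0 -(prim_order_dvd wn).
apply: (mulfI wd); rewrite mulr0; under eq_bigr do rewrite mulnC exprM.
by rewrite -subrX1 -exprM mulnC exprM (prim_expr_order wn) expr1n subrr.
Qed.

(** After expanding the squares, the terms with i = j have coefficient n, and the others vanish as
    sums over [l] of powers w^(l d) with n not dividing d. The exponent has [j.+1] because branches
    are numbered from 1. *)
Lemma parseval_prim_root (n : nat) (w : C) (h : 'I_n -> C) :
  n.-primitive_root w ->
  \sum_(l < n) `|\sum_(j < n) (w ^+ (l * j.+1))^* * h j| ^+ 2 =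
  n%:R * \sum_j `|h j| ^+ 2.
Proof.
move=> wn; have n0 := prim_order_gt0 wn.
have ww : w^* * w = 1.
  have := congr1 (fun z => `|z|) (prim_expr_order wn).
  rewrite normrX normr1 => /eqP; rewrite (pexpr_eq1 n0)// => /eqP w1.
  by rewrite mulrC -normCK w1 expr1n.
have wB (l i j : nat) : (i <= j)%N ->
    (w ^+ (l * i))^* * w ^+ (l * j) = w ^+ (l * (j - i)).
  move=> ij; rewrite -{1}(subnK ij) mulnDr exprD mulrCA rmorphXn -exprMn ww.
  by rewrite expr1n mulr1.
have orth (i j : 'I_n) : (i < j)%N ->
    \sum_(l < n) (w ^+ (l * i.+1))^* * w ^+ (l * j.+1) = 0.
  move=> ij; rewrite -[RHS](sum_prim_root wn (d := (j - i)%N)).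
    by apply: eq_bigr => l _; rewrite wB// ltnW.
  by rewrite gtnNdvd// ?subn_gt0// ltn_subLR ?ltn_addl// ltnW.
transitivity (\sum_(i < n) \sum_(j < n) h i * (h j)^* *
    \sum_(l < n) (w ^+ (l * i.+1))^* * w ^+ (l * j.+1)).
  transitivity (\sum_(l < n) \sum_(i < n) \sum_(j < n)
      ((w ^+ (l * i.+1))^* * h i) * ((w ^+ (l * j.+1))^* * h j)^*).
    apply: eq_bigr => l _; rewrite normCK big_distrl/=; apply: eq_bigr => i _.
    by rewrite rmorph_sum big_distrr.
  rewrite exchange_big/=; apply: eq_bigr => i _.
  rewrite exchange_big/=; apply: eq_bigr => j _.
  rewrite big_distrr/=; apply: eq_bigr => l _.
  by rewrite rmorphM/= conjCK; ring.
rewrite big_distrr/=; apply: eq_bigr => i _.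
rewrite (bigD1 i)//= [X in _ + X]big1 => [|j ji].
  rewrite addr0 -normCK mulrC; congr (_ * _).
  transitivity (\sum_(l < n) (1 : C)).
    by apply: eq_bigr => l _; rewrite wB// subnn muln0.
  by rewrite sumr_const card_ord.
have [ij|ij|ij] := ltngtP i j.
- by rewrite orth// mulr0.
(* [orth] is stated for i < j, since it subtracts natural numbers; conjugation gives the other
   half. *)
- rewrite [X in _ * X](_ : _ =
      (\sum_(l < n) (w ^+ (l * j.+1))^* * w ^+ (l * i.+1))^*).
    by rewrite orth// rmorph0 mulr0.
  by rewrite rmorph_sum; apply: eq_bigr => l _; rewrite rmorphM/= conjCK mulrC.
- by rewrite (val_inj ij) eqxx in ji.
Qed.

End HermitianSums.

(** * Elementary families *)

Section Elementary.
Variable R : realType.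

Lemma omegaX (n k : nat) :
  @omega R n ^+ k =
  cos (2 * pi / n%:R * k%:R) +i* sin (2 * pi / n%:R * k%:R).
Proof.
elim: k => [|k IH]; first by rewrite expr0 mulr0 cos0 sin0.
rewrite exprS IH /omega; set x := 2 * pi / n%:R.
have -> : x * k.+1%:R = x + x * k%:R by rewrite -natr1; ring.
rewrite cosD sinD; apply/eqP; rewrite eq_complex /=; apply/andP.
by split; apply/eqP; ring.
Qed.

(** If cos(2 x) = 1 then sin x = 0 by the double-angle formula, which is impossible for x = pi k / n
    with 0 < k < n. *)
Lemma omega_prim (n : nat) : (0 < n)%N -> n.-primitive_root (@omega R n).
Proof.
move=> n0; have nE : n%:R != 0 :> R by rewrite pnatr_eq0 -lt0n.
rewrite /primitive_root_of_unity n0; apply/forallP => -[i /= ltin].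
rewrite unity_rootE omegaX; apply/eqP; have [->|ni] := eqVneq i.+1 n.
  rewrite mulfVK// mulr_natl cos2pi sin2pi; exact/eqP.
have {ni}ltin : (i.+1 < n)%N by rewrite ltn_neqAle ni.
apply/negbTE/negP => /eqP[+ _].
set x := 2 * pi / n%:R * i.+1%:R.
have -> : x = (pi * (i.+1%:R / n%:R)) *+ 2 by rewrite /x; field.
rewrite cos_mulr2n cos2sin2 => c1.
have : 0 < sin (pi * (i.+1%:R / n%:R) : R).
  have ? : 0 < pi :> R by exact: pi_gt0.
  rewrite sin_gt0_pi// mulr_gt0 ?divr_gt0 ?ltr0n//= gtr_pMr//.
  by rewrite ltr_pdivrMr ?ltr0n// mul1r ltr_nat.
move=> /lt0r_neq0; rewrite -sqrf_eq0; apply/negP; rewrite negbK.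
by apply/eqP; lra.
Qed.

(** A ramp is an affine function clamped to [0, 1], even for [i = 0], where the affine part is -1.
    Bounds, monotonicity in [i] and continuity can be read off this form. *)
Lemma rampE (P : R) (i : nat) (x : R) : 0 < P -> 0 <= x ->
  ramp P i x = Num.max 0 (Num.min 1 (2 * i%:R / P * x - 1)).
Proof.
move=> P0 x0; rewrite /ramp; case: i => [|i] /=.
  by rewrite mulr0 !mul0r sub0r min_r ?max_l//; lra.
have i0 : 0 < i.+1%:R :> R by rewrite ltr0n.
have [t ->] : exists t, x = P * t by exists (x / P); field; rewrite gt_eqF.
have -> : 2 * i.+1%:R / P * (P * t) - 1 = 2 * (t * i.+1%:R) - 1.
  by field; rewrite gt_eqF.
have -> : (P / i.+1%:R <= P * t) = (1 <= t * i.+1%:R).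
  by rewrite ler_pdivrMr// -mulrA ler_pMr.
have -> : (P / (2 * i.+1%:R) <= P * t) = (1 <= 2 * (t * i.+1%:R)).
  by rewrite ler_pdivrMr ?mulr_gt0// -mulrA ler_pMr// mulrCA.
set z := t * _; rewrite minEle maxEle.
by case: (leP 1 z) => z1; case: (leP 1 (2 * z)) => z2;
  case: (leP 1 (2 * z - 1)) => z3;
  try case: (leP 0 _) => z4; lra.
Qed.

Lemma ramp_ge0 (P : R) (i : nat) (x : R) : 0 < P -> 0 <= x -> 0 <= ramp P i x.
Proof. by move=> P0 x0; rewrite rampE// le_max lexx. Qed.

Lemma ramp_le1 (P : R) (i : nat) (x : R) : 0 < P -> 0 <= x -> ramp P i x <= 1.
Proof. by move=> P0 x0; rewrite rampE// ge_max ler01 ge_min lexx. Qed.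

(** Keeps the radicand in [bump_fun] nonnegative, so that squaring [Num.sqrt] gives it back. *)
Lemma ramp_leS (P : R) (i : nat) (x : R) : 0 < P -> 0 <= x ->
  ramp P i x <= ramp P i.+1 x.
Proof.
move=> P0 x0; rewrite !rampE//; apply: le_max2 => //; apply: le_min2 => //.
rewrite lerD2r; apply: ler_wpM2r => //; apply: ler_wpM2r.
  by rewrite invr_ge0 ltW.
by rewrite ler_pM2l// ler_nat.
Qed.

Lemma conj_real_complex (a : R) : (a%:C)^* = a%:C.
Proof. exact: conjc_real. Qed.

Lemma sqr_norm_realM (a : R) (z : R[i]) :
  `|a%:C * z| ^+ 2 = (a ^+ 2)%:C * `|z| ^+ 2.
Proof.
rewrite normrM exprMn; congr (_ * _).
by rewrite normCK conj_real_complex rmorphXn expr2.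
Qed.

(** For one ramp index the family runs over the nontrivial characters of Z/n, all weighted by the
    same bump. Parseval minus the trivial character leaves n times the dispersion. With [i] and [l]
    counted from 0, the index (n - 1) i + l + 2 is that of the pair (i + 1, l + 1). *)
Lemma elementary_sum_iter (n : nat) (P : R) (i : nat) (t : R)
    (h : 'I_n -> R[i]) : (1 < n)%N -> 0 < P -> 0 <= t ->
  \sum_(0 <= l < n.-1)
    `|\sum_(a < n) (elementary_value n P (n.-1 * i + l).+2 a.+1 t)^* * h a| ^+ 2 =
  (ramp P i.+1 t - ramp P i t)%:C * dispersion h.
Proof.
move=> n1 P0 t0; have n0 : (0 < n)%N := ltnW n1.
have nE : n%:R != 0 :> R[i] by rewrite pnatr_eq0 -lt0n.
have vE l : (l < n.-1)%N ->
    `|\sum_(a < n) (elementary_value n P (n.-1 * i + l).+2 a.+1 t)^* * h a| ^+ 2 =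
    n%:R^-1 * (ramp P i.+1 t - ramp P i t)%:C *
    `|\sum_(a < n) ((@omega R n) ^+ (l.+1 * a.+1))^* * h a| ^+ 2.
  move=> ln.
  have -> : ((n.-1 * i + l).+2 = 1 + (n - 1) * (i.+1 - 1) + l.+1)%N.
    by rewrite !subn1 /= -addnA addnS.
  rewrite (_ : \sum_(a < n) _ = ((Num.sqrt n%:R)^-1 * bump_fun P i.+1 t)%:C *
      \sum_(a < n) ((@omega R n) ^+ (l.+1 * a.+1))^* * h a).
    rewrite sqr_norm_realM exprMn exprVn sqr_sqrtr// /bump_fun sqr_sqrtr.
      by rewrite rmorphM/= fmorphV/= rmorph_nat.
    by rewrite subr_ge0 ramp_leS.
  rewrite big_distrr/=; apply: eq_bigr => a _.
  rewrite elementary_valueE//; last by rewrite -ltnS prednK in ln.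
  by rewrite !rmorphM/= !conj_real_complex; ring.
under eq_big_nat => l ln do rewrite vE//.
rewrite -big_distrr/= mulrAC mulrC; congr (_ * _).
have := parseval_prim_root h (omega_prim n0).
rewrite -(big_mkord xpredT
  (fun l => `|\sum_(j < n) ((@omega R n) ^+ (l * j.+1))^* * h j| ^+ 2)).
(* The split-off term l = 0 is the trivial character, that is |sum_j h_j|^2. *)
rewrite big_ltn// big_add1 => /(canRL (addKr _)) ->.
rewrite mulrDr mulKf// addrC /dispersion mulrN; congr (_ - n%:R^-1 * `|_| ^+ 2).
by apply: eq_bigr => a _; rewrite mul0n expr0 conjC1 mul1r.
Qed.

(** The constant function [k = 1] contributes |sum_j h_j|^2 / n, and the other blocks telescope to
    r_M times the dispersion. For n = 1 the dispersion is 0 and only [k = 1] occurs. *)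
Lemma elementary_sum (n : nat) (P : R) (M : nat) (t : R) (h : 'I_n -> R[i]) :
  (0 < n)%N -> 0 < P -> 0 <= t ->
  \sum_(k <- index_iota 1 (2 + n.-1 * M))
    `|\sum_(a < n) (elementary_value n P k a.+1 t)^* * h a| ^+ 2 =
  \sum_a `|h a| ^+ 2 - (1 - ramp P M t)%:C * dispersion h.
Proof.
move=> n0 P0 t0; have [n1|n1] := leqP n 1.
  have {n0 n1} n1 : n = 1%N by apply/eqP; rewrite eqn_leq n1.
  subst n; rewrite /dispersion /index_iota mul0n big_seq1 !big_ord1.
  by rewrite invr1 mul1r subrr mulr0 subr0 /elementary_value/= conjC1 mul1r.
have nE : n%:R != 0 :> R[i] by rewrite pnatr_eq0 -lt0n.
rewrite big_ltn// add2n !big_add1/= sum_nat_mul.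
rewrite (eq_bigr _ (fun i _ => elementary_sum_iter i h n1 P0 t0)).
rewrite -big_distrl/= -rmorph_sum/= telescope_sumr// subr0.
rewrite (_ : \sum_(a < n) _ = (Num.sqrt n%:R)^-1%:C * \sum_a h a); last first.
  rewrite big_distrr/=; apply: eq_bigr => a _; rewrite /elementary_value/=.
  by rewrite (gtn_eqF n1) conj_real_complex.
rewrite sqr_norm_realM exprVn sqr_sqrtr// fmorphV/= rmorph_nat /dispersion.
by rewrite rmorphB rmorph1/=; ring.
Qed.

End Elementary.

(** * Continuity on the cograph and bounds for the module norm *)

Section Limits.
Variables (R : realType) (K : metricType R) (N : nat) (gamma : 'I_N -> K -> K).

(** The cograph is a finite union of closed graphs. Near [p], a graph through [p] is handled by
    continuity along that branch, and a graph missing [p] contains no nearby point. *)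
Lemma cograph_continuous (u : set_type (cograph gamma) -> R[i]^o) :
  (forall j, proper_contraction (gamma j)) ->
  (forall j, continuous (fun y => u (graph_pt gamma j y))) -> continuous u.
Proof.
move=> gc uc p.
have val_c : continuous (val : set_type (cograph gamma) -> K * K).
  exact: initial_continuous.
have snd_c : {for p, continuous (fun q : set_type (cograph gamma) => (val q).2)}.
  by apply: continuous_comp; [exact: val_c|exact: cvg_snd].
have fst_c : {for p, continuous (fun q : set_type (cograph gamma) => (val q).1)}.
  by apply: continuous_comp; [exact: val_c|exact: cvg_fst].
have FF : Filter (nbhs p) by exact: nbhs_filter.
apply/cvgrPdist_le => e e0.
suff near_j : forall j, \forall q \near p,
    q = graph_pt gamma j (val q).2 -> `|u p - u q| <= e.
  have := filter_forall FF near_j; apply: filterS => q qe.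
  have [j qj] := set_mem (valP q); apply: (qe j).
  exact: val_inj.
move=> j; have [pj|pj] := eqVneq ((val p).1 : K) (gamma j (val p).2).
  have pE : p = graph_pt gamma j (val p).2.
    apply: val_inj; rewrite [LHS]surjective_pairing; congr pair; exact: pj.
  have := continuous_comp snd_c (uc j _).
  move=> /cvgrPdist_le/(_ e e0); apply: filterS => q qe qj.
  by rewrite pE qj.
have gj_c : {for p, continuous (fun q : set_type (cograph gamma) => gamma j (val q).2)}.
  apply: (continuous_comp snd_c); exact: proper_contraction_continuous.
move: (@metric_hausdorff R K); rewrite open_hausdorff => /(_ _ _ pj).
move=> [[A B] /= [/set_mem pA /set_mem pB] [oA oB /eqP AB]].
have near_A : \forall q \near p, A (val q).1.
  by apply: fst_c; exact: open_nbhs_nbhs.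
have near_B : \forall q \near p, B (gamma j (val q).2).
  by apply: gj_c; exact: open_nbhs_nbhs.
apply: filterS2 near_A near_B => q /= Aq Bq qj; exfalso.
suff : (A `&` B) (val q).1 by rewrite AB.
by split => //; rewrite qj.
Qed.

Lemma module_norm_lt (f : set_type (cograph gamma) -> R[i]^o) (b e : R) :
  0 <= b -> 0 < e -> b < e ^+ 2 ->
  (forall y, \sum_j `|f (graph_pt gamma j y)| ^+ 2 <= b%:C) ->
  module_norm f < e.
Proof.
move=> b0 e0 be fb.
apply: (@le_lt_trans _ _ (Num.sqrt b)); last first.
  by rewrite -(ger0_norm (ltW e0)) -sqrtr_sqr ltr_sqrt// exprn_gt0.
rewrite /module_norm ler_wsqrtr// /sup_norm; set S := (X in sup X).
(* If [K] is empty, the supremum takes its default value 0. *)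
have [->|/set0P S0] := eqVneq S set0; first by rewrite sup0.
apply: ge_sup => // _ [y _ <-]; rewrite -lecR; apply: le_trans (fb y).
rewrite (_ : (Normc.normc _)%:C = `|inner f f y|)// /inner.
rewrite (eq_bigr (fun j => `|f (graph_pt gamma j y)| ^+ 2)) => [|j _]; last first.
  by rewrite normCK mulrC.
by rewrite ger0_norm// sumr_ge0// => j _; rewrite exprn_ge0.
Qed.

End Limits.

(** * Continuity of the bumps and of the elementary functions *)

Section Ramp.
Variables (R : realType).

Lemma bump_fun_continuous (P : R) (i : nat) (T : topologicalType) (t : T -> R) :
  0 < P -> (forall x, 0 <= t x) -> continuous t ->
  continuous (fun x => bump_fun P i (t x)).
Proof.
move=> P0 t0 tc.
have rc j : continuous (fun x => ramp P j (t x) : R^o).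
  pose g : T -> R^o := fun x => 2 * j%:R / P * t x - 1.
  have -> : (fun x => ramp P j (t x) : R^o) = (cst 0 \max (cst 1 \min g)).
    by apply/funext => x; rewrite rampE.
  move=> x; apply: continuous_max; first exact: cvg_cst.
  apply: continuous_min; first exact: cvg_cst.
  apply: (@cvgB R R^o); last exact: cvg_cst.
  by apply: (@cvgM R); [exact: cvg_cst|exact: tc].
move=> x; apply: (@continuous_comp _ _ _ (fun x => ramp P i (t x) - ramp P i.-1 (t x))
  Num.sqrt); last exact: sqrt_continuous.
by apply: (@cvgB R R^o); exact: rc.
Qed.

Lemma real_complex_continuous : continuous (fun x : R => x%:C : R[i]^o).
Proof.
move=> x; apply/cvgrPdist_le => e e0.
(* Radii live in [R[i]], whose positive elements are real. *)
have e_real : e = (complex.Re e)%:C.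
  by rewrite RRe_real// gtr0_real.
have Re_e0 : 0 < complex.Re e by rewrite -ltcR -e_real.
have /cvgrPdist_le/(_ _ Re_e0) := @cvg_id _ (nbhs (x : R^o)).
apply: filterS => y; rewrite -lecR -e_real.
by rewrite -rmorphB normc_def/= expr0n addr0 sqrtr_sqr.
Qed.

Lemma elementary_value_continuous (n : nat) (P : R) (k j : nat) (T : topologicalType)
    (t : T -> R) : 0 < P -> (forall x, 0 <= t x) -> continuous t ->
  continuous (fun x => elementary_value n P k j (t x) : R[i]^o).
Proof.
move=> P0 t0 tc x; rewrite /elementary_value.
case: (n == 1%N); first exact: cvg_cst.
case: (k == 1%N); first exact: cvg_cst.
apply: (@cvgM R[i] _ (nbhs x) _ (cst _) (fun x => (bump_fun P _ (t x))%:C)).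
  exact: cvg_cst.
apply: (@continuous_comp _ _ _ (fun x => bump_fun P _ (t x)) (fun z => z%:C : R[i]^o)).
  exact: bump_fun_continuous.
exact: real_complex_continuous.
Qed.

End Ramp.

(** * The patched family *)

Section PatchedFamily.
Variables (R : realType) (K : metricType R) (N : nat) (gamma : 'I_N -> K -> K).
Variable D : patching gamma.

Local Notation ix i := 'I_(nb_values (pt_r (p := D)) i).
Local Notation J s := (branches gamma (pt_c (p := D)) (pt_b (p := D)) s).
Local Notation enumJ s := (pt_enumJ (p := D) (s := s)).
Local Notation W i := (closure (patch_nbhd (pt_U (p := D)) (pt_V (p := D)) i)).
Local Notation center i := (omap (pt_c (p := D)) i).

(** The value 0 at [None] is the one [elementary] takes for a missing centre, so that both kinds of
    pieces share one formula. *)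
Definition center_dist (i : option 'I_(pt_m D)) (y : K) : R :=
  if i is Some i0 then mdist y (pt_c i0) else 0.

Lemma center_dist_ge0 i y : 0 <= center_dist i y.
Proof. by case: i => [i|] //=; exact: mdist_ge0. Qed.

Lemma psi_eq0 i y : ~ W i y -> pt_psi i y = 0.
Proof.
move=> Wy; apply/eqP/negPn/negP => psi0; apply: Wy.
apply: subset_closure; apply: (@pt_psi_supp _ _ _ _ D i).
exact: subset_closure.
Qed.

(** The closure of U_i meets the branch set only in c_i. The closure of the last piece misses it,
    since V_i is a neighbourhood of c_i disjoint from that piece; there the conclusion
    [None = Some y] expresses absurdity. *)
Lemma branch_set_W y i : W i y -> branch_set gamma y -> center i = Some y.
Proof.
case: i => [i|] Wy gy /=.
  have : (branch_set gamma `&` closure (pt_U i)) y by [].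
  by rewrite pt_U_branch => ->.
exfalso; move: gy; rewrite -(pt_c_range D) => -[i _ iy].
have /Wy[z [/= zV Vz]] : nbhs y (pt_V i).
  by rewrite -iy; apply: open_nbhs_nbhs; split; [exact: pt_V_open|exact: pt_V_c].
by apply: zV; exists i => //; exact: subset_closure.
Qed.

(** An injection into a finite set of the same cardinality is onto. *)
Lemma enumJ_surj i (s : ix i) (j : 'I_N) : j \in J s ->
  exists a, j = enumJ s a.
Proof.
move=> jJ; apply/codomP.
have card_im : #|codom (enumJ s)| = #|J s|.
  by rewrite card_codom ?card_ord//; exact: pt_enumJ_inj.
have im_sub : codom (enumJ s) \subset J s.
  by apply/fintype.subsetP => _ /codomP[a ->]; exact: pt_enumJ_in.
by have /subset_cardP/(_ im_sub) -> := card_im.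
Qed.

Lemma sum_enumJ (V : nmodType) i (s : ix i) (F : 'I_N -> V) :
  \sum_(a < #|J s|) F (enumJ s a) =
  \sum_(j in J s) F j.
Proof.
rewrite [RHS](reindex_omap (enumJ s)
  (fun j => [pick a | j == pt_enumJ a])).
  apply: eq_bigl => a; rewrite pt_enumJ_in/=; case: pickP => [b /eqP|/(_ a)].
    by move=> /pt_enumJ_inj ->; rewrite eqxx.
  by rewrite eqxx.
move=> j /enumJ_surj[a ->]; case: pickP => [b /eqP/=|/(_ a)]; last by rewrite eqxx.
by move=> /pt_enumJ_inj ->.
Qed.

Lemma J_unique i j : exists s0 : ix i,
  forall s, (j \in J s) = (s == s0).
Proof.
case: i => [i|] /=; last by exists j => s'; rewrite inE eq_sym.
have : range (fun j => gamma j (pt_c i)) (gamma j (pt_c i)) by exists j.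
rewrite -(pt_b_range (p := D) i) => -[s _ sj]; exists s => s'; rewrite inE -sj.
by rewrite (inj_eq (pt_b_inj (p := D) (i := i))) eq_sym.
Qed.

Lemma sum_J (V : nmodType) i (F : 'I_N -> V) :
  \sum_(s : ix i) \sum_(j in J s) F j = \sum_j F j.
Proof.
rewrite (exchange_big_dep xpredT)//=; apply: eq_bigr => j _.
have [s sP] := J_unique i j.
by rewrite (eq_bigl _ _ sP) big_pred1_eq.
Qed.

Lemma card_J_gt0 i (s : ix i) : (0 < #|J s|)%N.
Proof.
case: i s => [i|] s /=; last by rewrite cards1.
have : range (pt_b (i := i)) (pt_b s) by exists s.
rewrite (pt_b_range (p := D) i) => -[j _ sj].
by apply/card_gt0P; exists j; rewrite inE; exact/eqP.
Qed.

Lemma J_gamma i (s : ix i) (j j' : 'I_N) c : center i = Some c ->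
  j \in J s -> (j' \in J s) = (gamma j' c == gamma j c).
Proof. by case: i s => [i|//] s /= [<-]; rewrite !inE => /eqP ->. Qed.

(** [pick] may return another branch through the same point only if [y] is a branch point in W_i,
    hence y = c_i, where the two values agree; on the last piece this cannot happen. Off W_i the
    factor psi_i vanishes. *)
Lemma patched_family_enumJ i (s : ix i) k a y :
  patched_family (Tagged _ (s, k) : patch_index_type D)
    (graph_pt gamma (enumJ s a) y) =
  elementary_value #|J s| (pt_P s) k a.+1 (center_dist i y) *
    (Num.sqrt (pt_psi i y))%:C.
Proof.
rewrite /patched_family/=; have [Wy|/psi_eq0 ->] := pselect (W i y); last first.
  by rewrite sqrtr0 !mulr0.
congr (_ * _); rewrite /local_family.
have inj_off b b' : gamma (enumJ s b) y =
    gamma (pt_enumJ b') y -> b != b' -> center i = Some y.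
  move=> gbb bb'; apply: branch_set_W => //.
  exists (pt_enumJ b), (pt_enumJ b'); split=> //.
  by apply: contra_neq bb'; exact: pt_enumJ_inj.
case: i s a Wy inj_off => [i|] s a Wy inj_off.
  rewrite elementaryE ?pt_P_gt0// => {}y' j j' Wy' gy' jj'.
  have : center (Some i) = Some y'.
    apply: branch_set_W => //.
    exists (pt_enumJ j), (pt_enumJ j'); split=> //.
    by apply: contra_neq jj'; exact: pt_enumJ_inj.
  by case.
rewrite /elementary; case: pickP => [b /andP[_ /eqP/= gab]|/(_ a)]/=.
  by have [->//|/(inj_off _ _ gab)] := eqVneq a b.
by rewrite mem_set// eqxx.
Qed.

(** If (gamma_j y, y) also lay on a branch b in J_(i,s) with y in W_i, then y = c_i, and gamma_j c_i
    = gamma_b c_i would put j in J_(i,s). *)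
Lemma patched_family_notin i (s : ix i) k j y : j \notin J s ->
  patched_family (Tagged _ (s, k) : patch_index_type D) (graph_pt gamma j y) = 0.
Proof.
move=> jJ; rewrite /patched_family/=.
have [Wy|/psi_eq0 ->] := pselect (W i y); last by rewrite sqrtr0 mulr0.
rewrite /local_family /elementary; case: pickP => [b /andP[_ /eqP/= gb]|];
  last by rewrite mul0r.
exfalso; move/negP: jJ; apply.
have bJ := pt_enumJ_in b.
have [->//|jb] := eqVneq j (pt_enumJ b).
rewrite (@J_gamma _ _ _ j y _ bJ) ?gb//.
by apply: branch_set_W => //; exists j, (pt_enumJ b).
Qed.

(* In each (i, s) these k are the ones whose ramp index is at most M; when   *)
(* #J_(i,s) = 1 only k = 1 is left.                                           *)
Definition index_upto (M : nat) : seq (patch_index_type D) :=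
  [seq (Tagged (fun i => (ix i * nat)%type) x : patch_index_type D) |
    i <- enum {: option 'I_(pt_m D)},
    x <- [seq (s, k) | s <- enum {: ix i}, k <- index_iota 1 (2 + #|J s|.-1 * M)]].

Lemma index_upto_uniq M : uniq (index_upto M).
Proof.
apply: allpairs_uniq_dep => [|i _|]; first exact: enum_uniq.
  apply: allpairs_uniq_dep => [|s _|]; [exact: enum_uniq|exact: iota_uniq|].
  by move=> [s k] [s' k'] _ _ /= [-> ->].
move=> [i x] [i' x'] _ _ /= ii'.
by have := congr1 (fun z => Tagged (fun i => (ix i * nat)%type) (tagged z)) ii'.
Qed.

Lemma mem_index_upto M i (s : ix i) k :
  ((Tagged _ (s, k) : patch_index_type D) \in index_upto M) =
  (0 < k < 2 + #|J s|.-1 * M)%N.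
Proof.
apply/allpairsPdep/idP => [[i' [x [_ /allpairsPdep[s' [k' [_ + ->]]]]]]|ks].
  rewrite mem_index_iota => /[swap] ik.
  have ii' : i' = i by exact: (esym (congr1 tag ik)).
  by subst i'; move/eqP: ik; rewrite eq_Tagged => /eqP[-> ->].
exists i, (s, k); split; rewrite ?mem_enum//.
by apply/allpairsPdep; exists s, k; split; rewrite ?mem_enum// mem_index_iota.
Qed.

Lemma index_upto_patch_index M x : x \in index_upto M -> patch_index x.
Proof.
case: x => i [s k]; rewrite mem_index_upto /patch_index/= /elementary_index.
case: ifPn => [/eqP -> /=|_ /andP[]//].
by rewrite mul0n => /andP[k0 k2]; apply/eqP; rewrite eqn_leq k0 andbT -ltnS.
Qed.

Lemma patch_index_upto M (x : patch_index_type D) :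
  patch_index x -> ((tagged x).2 <= M)%N -> x \in index_upto M.
Proof.
case: x => i [s k]/=; rewrite mem_index_upto /patch_index/= /elementary_index.
case: ifPn => [/eqP Js /= -> _|Js1 /= k0 kM]; first by rewrite ltn_addr.
rewrite k0/= ltnS (leq_trans kM)// leqW// leq_pmull//.
have := card_J_gt0 s; move: Js1; by case: #|J s| => [|[|]].
Qed.

Lemma fset_index_upto (F : {fset patch_index_type D}) :
  [set` F] `<=` patch_index (D := D) ->
  exists M, {subset (F : seq _) <= index_upto M}.
Proof.
move=> FD; exists (\max_(x <- F) (tagged x).2)%N => x xF.
apply: patch_index_upto; first exact: FD.
by rewrite (big_rem x)//= leq_maxl.
Qed.

(** * Parseval's identity with defect and Bessel's inequality for the patched family *)

Lemma patched_inner i (s : ix i) k y (h : 'I_N -> R[i]) :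
  \sum_j (patched_family (Tagged _ (s, k) : patch_index_type D)
    (graph_pt gamma j y))^* * h j =
  (Num.sqrt (pt_psi i y))%:C *
  \sum_(a < #|J s|)
    (elementary_value #|J s| (pt_P s) k a.+1 (center_dist i y))^* * h (enumJ s a).
Proof.
rewrite (bigID (mem (J s)))/= [X in _ + X]big1 => [|j jJ]; last first.
  by rewrite patched_family_notin// conjC0 mul0r.
rewrite addr0 -sum_enumJ big_distrr/=; apply: eq_bigr => a _.
by rewrite patched_family_enumJ rmorphM/= conj_real_complex mulrAC mulrC.
Qed.

(** For each [i] the sets J_(i,s) partition the branches, so [elementary_sum] adds up over [s] to
    |h|^2 minus a defect; the weights psi_i sum to 1. *)
Lemma patched_inner_sum M y (h : 'I_N -> R[i]) :
  \sum_(x <- index_upto M)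
    `|\sum_j (patched_family x (graph_pt gamma j y))^* * h j| ^+ 2 =
  \sum_j `|h j| ^+ 2 -
  \sum_i (pt_psi i y)%:C * \sum_(s : ix i)
    (1 - ramp (pt_P s) M (center_dist i y))%:C * dispersion (fun a => h (enumJ s a)).
Proof.
rewrite big_allpairs_dep big_enum.
have -> : \sum_j `|h j| ^+ 2 = \sum_i (pt_psi (p := D) i y)%:C * \sum_j `|h j| ^+ 2.
  by rewrite -big_distrl/= -rmorph_sum/= pt_psi_sum mul1r.
rewrite -sumrB; apply: eq_bigr => i _; rewrite -mulrBr.
rewrite -(sum_J i) -sumrB big_distrr big_allpairs_dep big_enum.
apply: eq_bigr => s _; rewrite -sum_enumJ -elementary_sum ?card_J_gt0//; last 2 first.
- exact: pt_P_gt0.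
- exact: center_dist_ge0.
rewrite big_distrr/=; apply: eq_bigr => k _.
by rewrite patched_inner sqr_norm_realM sqr_sqrtr// pt_psi_ge0.
Qed.

(** A finite subfamily sits in some [index_upto D M], whose defect is nonnegative. [h] is arbitrary,
    as [residual_le_of_bessel] applies the inequality to the partial sum itself. *)
Lemma patched_bessel (F : {fset patch_index_type D}) y (h : 'I_N -> R[i]) :
  [set` F] `<=` patch_index (D := D) ->
  \sum_(x <- F) `|\sum_j (patched_family x (graph_pt gamma j y))^* * h j| ^+ 2
  <= \sum_j `|h j| ^+ 2.
Proof.
move=> /fset_index_upto[M FM].
apply: le_trans (ler_sum_subseq_mem _ FM _) _ => [|x|]; rewrite ?exprn_ge0//.
rewrite patched_inner_sum gerDl oppr_le0; apply: sumr_ge0 => i _.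
rewrite mulr_ge0 ?ler0c ?pt_psi_ge0//; apply: sumr_ge0 => s _.
rewrite mulr_ge0 ?dispersion_ge0 ?card_J_gt0// ler0c subr_ge0 ramp_le1//.
  exact: pt_P_gt0.
exact: center_dist_ge0.
Qed.

(** * Continuity of the patched functions and uniform decay of the defect *)

Hypothesis gamma_contr : forall j : 'I_N, proper_contraction (gamma j).

Lemma center_dist_continuous (i : option 'I_(pt_m D)) :
  continuous (center_dist i : K -> R).
Proof.
case: i => [i|] y; last exact: cvg_cst.
apply/cvgrPdist_lt => e e0.
have := nbhsx_ballx y e e0; apply: filterS => z; rewrite ballEmdist/= => yz.
have yzc := metric_triangle y z (pt_c i).
have zyc := metric_triangle z y (pt_c i).
by rewrite (metric_sym z y) in zyc; rewrite /= ltr_norml; apply/andP; split; lra.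
Qed.

Lemma patched_family_X_gamma (x : patch_index_type D) : X_gamma (patched_family x).
Proof.
rewrite /X_gamma/=; case: x => i [s k]; apply: cograph_continuous => // j.
have [/enumJ_surj[a ->]|jJ] := boolP (j \in J s).
  under eq_fun do rewrite patched_family_enumJ.
  move=> y; apply: (@cvgM R[i] _ (nbhs y) _
    (fun y => elementary_value #|J s| (pt_P s) k a.+1 (center_dist i y))
    (fun y => (Num.sqrt (pt_psi i y))%:C)).
    apply: elementary_value_continuous; first exact: pt_P_gt0.
      by move=> z; exact: center_dist_ge0.
    exact: center_dist_continuous.
  apply: (@continuous_comp _ _ _ (pt_psi i) (fun z => (Num.sqrt z)%:C : R[i]^o)).
    exact: pt_psi_continuous.
  apply: (@continuous_comp _ _ _ Num.sqrt (fun z => z%:C : R[i]^o)).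
    exact: sqrt_continuous.
  exact: real_complex_continuous.
under eq_fun do rewrite patched_family_notin//.
by move=> y; exact: cvg_cst.
Qed.

(** Either d(y, c_i) >= P / M, and 1 - r_M vanishes, or [y] is so close to c_i that the values of
    [f] on the branches in J_(i,s) are all within [e] of their common value at c_i. The threshold
    for [M] does not depend on [y]. *)
Lemma near_dispersion (f : set_type (cograph gamma) -> R[i]^o) (e : R)
    (i : option 'I_(pt_m D)) (s : ix i) : X_gamma f -> 0 < e ->
  \forall M \near \oo, forall y,
    (1 - ramp (pt_P s) M (center_dist i y))%:C *
      dispersion (fun a => f (graph_pt gamma (enumJ s a) y)) <=
    #|J s|%:R * (e ^+ 2)%:C.
Proof.
move=> fX e0.
have r01 M y : 0 <= 1 - ramp (pt_P s) M (center_dist i y) <= 1.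
  have P0 := pt_P_gt0 s; have t0 := center_dist_ge0 i y.
  by rewrite subr_ge0 ramp_le1//= gerBl ramp_ge0.
have le_of_close M y (z : R[i]) :
    (forall a, `|f (graph_pt gamma (enumJ s a) y) - z| <= e%:C) ->
    (1 - ramp (pt_P s) M (center_dist i y))%:C *
      dispersion (fun a => f (graph_pt gamma (enumJ s a) y)) <=
    #|J s|%:R * (e ^+ 2)%:C.
  move=> close; have /andP[r0 r1] := r01 M y.
  apply: (@le_trans _ _ (1 * dispersion (fun a => f (graph_pt gamma (enumJ s a) y)))).
    by rewrite ler_wpM2r ?dispersion_ge0 ?card_J_gt0// lecR.
  rewrite mul1r; apply: le_trans (dispersion_le _ z (card_J_gt0 s)) _.
  rewrite mulr_natl -[X in _ *+ X]card_ord -sumr_const.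
  by apply: ler_sum => a _; rewrite rmorphXn/= lerXn2r// nnegrE// ler0c ltW.
(* On the last piece J is a singleton, so [z] can be the only value itself. *)
case: i s r01 le_of_close => [i|] s r01 le_of_close; last first.
  near=> M => y; apply: (le_of_close _ _ (f (graph_pt gamma s y))) => a.
  have := pt_enumJ_in a; rewrite inE => /eqP ->.
  by rewrite subrr normr0 ler0c ltW.
have : \forall y \near pt_c i, forall j,
    `|f (graph_pt gamma j (pt_c i)) - f (graph_pt gamma j y)| <= e%:C.
  apply: filter_forall => j.
  have : {for pt_c i, continuous (fun y => f (graph_pt gamma j y))}.
    by apply: continuous_comp; [exact: graph_pt_continuous|exact: fX].
  by move=> /cvgrPdist_le; apply; rewrite ltcR.
move=> /nbhs_ballP[r /= r_gt0 close_c].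
have P0 : 0 < pt_P s := pt_P_gt0 s.
near=> M => y.
have M0 : 0 < M%:R :> R by near: M; exact: nbhs_infty_gtr.
have PM : pt_P s / M%:R < r.
  by rewrite ltr_pdivrMr// -ltr_pdivrMl// mulrC; near: M; exact: nbhs_infty_gtr.
have [far|close] := leP (pt_P s / M%:R) (mdist y (pt_c i)).
  (* M > 0 matters here: r_0 is 0, not 1. *)
  rewrite /ramp/= far -(eqr_nat R) gt_eqF// subrr mul0r.
  by rewrite mulr_ge0// ler0c exprn_ge0// ltW.
have a0 : 'I_#|J s| by exists 0%N; exact: card_J_gt0.
apply: (le_of_close _ _ (f (graph_pt gamma (enumJ s a0) (pt_c i)))) => a.
have -> : graph_pt gamma (enumJ s a0) (pt_c i) = graph_pt gamma (enumJ s a) (pt_c i).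
  apply: val_inj => /=; congr pair; apply/eqP.
  by rewrite -(@J_gamma (Some i) s (enumJ s a)) ?pt_enumJ_in.
rewrite distrC; apply: close_c; rewrite ballEmdist/=.
by rewrite (metric_sym (pt_c i)) (lt_trans close).
Unshelve. all: by end_near. Qed.

End PatchedFamily.

Theorem theorem4p3 (R : realType) (K : metricType R) (N : nat)
    (gamma : 'I_N -> K -> K) (N_ge2 : (2 <= N)%N)
    (K_compact : compact [set: K])
    (gamma_contr : forall j : 'I_N, proper_contraction (gamma j))
    (gamma_branch : finite_branch_condition gamma)
    (D : patching gamma) :
  is_basis (patch_index (D := D)) (patched_family (D := D)).
Proof.
split=> [|x _|f e fX e0].
- exact: (@countableP
    {i : option 'I_(pt_m D) & ('I_(nb_values (pt_r (p := D)) i) * nat)%type}).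
- exact: patched_family_X_gamma.
(* The total defect will be at most N d^2, which is below e^2 because N < (N + 1)^2. *)
pose d : R := e / N.+1%:R.
have N1 : 0 < N.+1%:R :> R by rewrite ltr0n.
have d0 : 0 < d by rewrite divr_gt0.
have [M HM] : exists M, forall i (s : 'I_(nb_values (pt_r (p := D)) i)) y,
    (1 - ramp (pt_P s) M (center_dist i y))%:C *
      dispersion (fun a => f (graph_pt gamma (pt_enumJ (s := s) a) y)) <=
    #|branches gamma (pt_c (p := D)) (pt_b (p := D)) s|%:R * (d ^+ 2)%:C.
  apply: (@filter_ex _ \oo); apply: (@filter_forall nat (option 'I_(pt_m D)) _ \oo) => i.
  apply: (@filter_forall nat 'I_(nb_values (pt_r (p := D)) i) _ \oo) => s.
  exact: near_dispersion.
exists [fset x in index_upto D M]%fset => [x|F F0F FD].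
  by rewrite /= inE; exact: index_upto_patch_index.
apply: (@module_norm_lt _ _ _ _ _ (N%:R * d ^+ 2)) => // [||y].
- by rewrite mulr_ge0// exprn_ge0// ltW.
- rewrite /d expr_div_n mulrCA gtr_pMr ?exprn_gt0// ltr_pdivrMr ?exprn_gt0// mul1r.
  by rewrite -natrX ltr_nat (leq_trans (ltnSn N))// -[X in (X <= _)%N]expn1 leq_pexp2l.
pose u x j := patched_family (D := D) x (graph_pt gamma j y).
pose g j := f (graph_pt gamma j y).
have -> : \sum_j `|(\sum_(k <- F)
        ract (patched_family k) (inner (patched_family k) f) - f)
      (graph_pt gamma j y)| ^+ 2 =
    \sum_j `|\sum_(x <- F) u x j * (\sum_j' (u x j')^* * g j') - g j| ^+ 2.
  apply: eq_bigr => j _; congr (`|_| ^+ 2).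
  by rewrite fctE fct_sumE.
apply: le_trans (residual_le_of_bessel _ (fun h => patched_bessel y h FD)) _.
(* Passing from [F] back to [F0] drops nonnegative terms from the subtracted sum. *)
apply: (@le_trans _ _ (\sum_j `|g j| ^+ 2 -
    \sum_(x <- index_upto D M) `|\sum_j (u x j)^* * g j| ^+ 2)).
  rewrite lerD2l lerN2; apply: ler_sum_subseq_mem => [|x xM|x].
  - exact: index_upto_uniq.
  - by apply: (fsubsetP F0F); rewrite inE.
  - by rewrite exprn_ge0.
rewrite patched_inner_sum opprB addrC subrK.
(* For each [i] the cardinalities of the J_(i,s) add up to N, and the weights psi_i average the
   resulting bound N d^2. *)
apply: (@le_trans _ _ (\sum_i (pt_psi (p := D) i y)%:C * (N%:R * (d ^+ 2)%:C))).
  apply: ler_sum => i _; rewrite ler_wpM2l ?ler0c ?pt_psi_ge0//.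
  apply: le_trans (ler_sum _ (fun s _ => HM i s y)) _.
  rewrite -big_distrl/= -natr_sum; under eq_bigr do rewrite -sum1_card.
  by rewrite sum_J sum1_card card_ord.
rewrite -big_distrl/= -rmorph_sum/= pt_psi_sum mul1r.
by rewrite -(rmorph_nat (real_complex R)) -rmorphM.
Qed.
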